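(* At every iteration $k$, the DD algorithm (defined in the context) generates $\mu^k(x_0;x)$ and $\theta^k(x_0;x)$ whose entries are ratios of homogeneous polynomials in $(x_0;x)$.
   Context: DD algorithm. Input $\bar A\in\mathbb R^{m\times(n+1)}$ with rows $\bar A_{1,:},\dots,\bar A_{m,:}$. Coordinates of $\mathbb R^{n+1}$ are indexed $0,\dots,n$; points are written $(x_0;x)$; $e_0,\dots,e_n$ are the unit vectors. The algorithm produces matrices $R^k$ ($p_k$ columns) and $L^k$ ($q_k$ columns) with $n+1$ rows, and vectors of functions $\mu^k$ (length $p_k$) and $\theta^k$ (length $q_k$) of $(x_0;x)$. Initialization: $L^0=(e_1,\dots,e_n)$, $\theta^0=x$, $R^0=(e_0)$, $\mu^0=(x_0)$. Iteration $k=1,\dots,m$: write $L,\theta,R,\mu,p,q$ for $L^{k-1},\theta^{k-1},R^{k-1},\mu^{k-1},p_{k-1},q_{k-1}$, and set $\alpha=\bar A_{k,:}L$, $\beta=\bar A_{k,:}R$. Case 1 ($q>0$ and $\alpha\ne0$): let $\xi=\min\{i\mid\alpha_i\neq0\}$; if $\alpha_\xi<0$ replace (in place) $L_{:,\xi},\theta_\xi,\alpha_\xi$ by their negatives. Set $\mu^k=\bigl(\theta_\xi+\sum_{j=\xi+1}^{q}\alpha_j\theta_j/\alpha_\xi+\sum_{j=1}^{p}\beta_j\mu_j/\alpha_\xi,\ (\mu_j/\alpha_\xi)_{j=1}^{p}\bigr)$, $\theta^k=\bigl((\theta_j)_{j<\xi},(\theta_j/\alpha_\xi)_{j>\xi}\bigr)$,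 $R^k=\bigl(L_{:,\xi},(\alpha_\xi R_{:,j}-\beta_jL_{:,\xi})_{j=1}^{p}\bigr)$, $L^k=\bigl((L_{:,j})_{j<\xi},(\alpha_\xi L_{:,j}-\alpha_jL_{:,\xi})_{j>\xi}\bigr)$. Case 2 (otherwise): let $N^-,N^0,N^+$ be the sets of $i$ with $\beta_i<0$, $=0$, $>0$, and $N_{\rm tot}=\sum_{i\in N^+}\mu_i\beta_i$. Set $\mu^k=\bigl(\mu_{N^0},(\mu_i+\sum_{j\in N^-}\mu_j\mu_i\beta_j/N_{\rm tot})_{i\in N^+},(\mu_j\mu_i/N_{\rm tot})_{i\in N^+,j\in N^-}\bigr)$, $R^k=\bigl(R_{:,N^0},R_{:,N^+},(\beta_iR_{:,j}-\beta_jR_{:,i})_{i\in N^+,j\in N^-}\bigr)$, $\theta^k=\theta$, $L^k=L$. *)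

(* Defs.v *)
From mathcomp Require Import all_boot all_order all_algebra.
From mathcomp Require Import reals.
From mathcomp Require Import mpoly.

Set Implicit Arguments.
Unset Strict Implicit.
Unset Printing Implicit Defensive.

Import Order.TTheory GRing.Theory Num.Theory.
Local Open Scope ring_scope.

Section DoubleDescription.
Variables (R : realType) (n : nat).

(* A point (x_0; x) of the space is a column vector; coordinate 0 is x_0. *)
Local Notation point := 'cV[R]_n.+1.
Local Notation func := (point -> R).

Definition fun0 : func := fun=> 0.

(* A matrix with a varying number of columns is the sequence of its columns;
   all column indices below start at 0. *)
Record dd_state := DDState {
  dd_L : seq point;
  dd_theta : seq func;
  dd_R : seq point;
  dd_mu : seq func }.

Definition dd_init : dd_state :=
  {| dd_L := [seq delta_mx (lift ord0 i) 0 | i <- enum 'I_n];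
     dd_theta := [seq (fun v : point => v (lift ord0 i) 0) | i <- enum 'I_n];
     dd_R := [:: delta_mx ord0 0];
     dd_mu := [:: (fun v : point => v ord0 0)] |}.

Definition row_times (a : 'rV[R]_n.+1) (cols : seq point) : seq R :=
  [seq (a *m c) 0 0 | c <- cols].

(* alpha has a nonzero entry; this covers both q > 0 and alpha != 0. *)
Definition dd_case1 (a : 'rV[R]_n.+1) (s : dd_state) : bool :=
  has (fun c => c != 0) (row_times a (dd_L s)).

(* The in-place sign change only affects the column xi, so it is recorded in
   Lxi, txi and axi, the possibly negated L_{:,xi}, theta_xi and alpha_xi. *)
Definition dd_step1 (a : 'rV[R]_n.+1) (s : dd_state) : dd_state :=
  let: DDState L theta Rm mu := s in
  let q := size L in
  let p := size Rm in
  let alpha := row_times a L in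
  let beta := row_times a Rm in
  let xi := find (fun c => c != 0) alpha in
  let flip := alpha`_xi < 0 in
  let axi := if flip then - alpha`_xi else alpha`_xi in
  let Lxi := if flip then - L`_xi else L`_xi in
  let txi : func := fun v =>
    if flip then - nth fun0 theta xi v else nth fun0 theta xi v in
  {| dd_L := take xi L ++
       [seq axi *: L`_j - alpha`_j *: Lxi | j <- iota xi.+1 (q - xi.+1)];
     dd_theta := take xi theta ++
       [seq (fun v => nth fun0 theta j v / axi) | j <- iota xi.+1 (q - xi.+1)];
     dd_R := Lxi :: [seq axi *: Rm`_j - beta`_j *: Lxi | j <- iota 0 p];
     dd_mu :=
       (fun v => txi v
          + \sum_(xi.+1 <= j < q) alpha`_j * nth fun0 theta j v / axi
          + \sum_(0 <= j < p) beta`_j * nth fun0 mu j v / axi)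
       :: [seq (fun v => nth fun0 mu j v / axi) | j <- iota 0 p] |}.

Definition dd_Nneg (beta : seq R) : seq nat :=
  [seq i <- iota 0 (size beta) | beta`_i < 0].
Definition dd_Nzero (beta : seq R) : seq nat :=
  [seq i <- iota 0 (size beta) | beta`_i == 0].
Definition dd_Npos (beta : seq R) : seq nat :=
  [seq i <- iota 0 (size beta) | 0 < beta`_i].

Definition dd_Ntot (beta : seq R) (mu : seq func) : func :=
  fun v => \sum_(i <- dd_Npos beta) nth fun0 mu i v * beta`_i.

Definition dd_step2 (a : 'rV[R]_n.+1) (s : dd_state) : dd_state :=
  let: DDState L theta Rm mu := s in
  let beta := row_times a Rm in
  let Nneg := dd_Nneg beta in
  let Nzero := dd_Nzero beta in
  let Npos := dd_Npos beta in
  let Ntot := dd_Ntot beta mu in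
  let mu_ i := nth fun0 mu i in
  {| dd_L := L;
     dd_theta := theta;
     dd_R := [seq Rm`_i | i <- Nzero] ++ [seq Rm`_i | i <- Npos] ++
       [seq beta`_i *: Rm`_j - beta`_j *: Rm`_i | i <- Npos, j <- Nneg];
     dd_mu := [seq mu_ i | i <- Nzero] ++
       [seq (fun v => mu_ i v
               + \sum_(j <- Nneg) mu_ j v * mu_ i v * beta`_j / Ntot v)
         | i <- Npos] ++
       [seq (fun v => mu_ j v * mu_ i v / Ntot v) | i <- Npos, j <- Nneg] |}.

Definition dd_step (s : dd_state) (a : 'rV[R]_n.+1) : dd_state :=
  if dd_case1 a s then dd_step1 a s else dd_step2 a s.

(* The functions produced by the algorithm are total because x / 0 = 0 in R.
   The two definitions below single out the points at which this convention is
   not used.  The only divisor that depends on the point is Ntot; it is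
   actually used as a divisor only if both N^+ and N^- are nonempty. *)
Definition dd_step_defined (a : 'rV[R]_n.+1) (s : dd_state) (v : point) : bool :=
  let beta := row_times a (dd_R s) in
  [&& ~~ dd_case1 a s, dd_Npos beta != [::] & dd_Nneg beta != [::]]
    ==> (dd_Ntot beta (dd_mu s) v != 0).

Fixpoint dd_run_defined (rows : seq 'rV[R]_n.+1) (s : dd_state) (v : point) :
    bool :=
  if rows is a :: rows' then
    dd_step_defined a s v && dd_run_defined rows' (dd_step s a) v
  else true.

Section Input.
Variables (m : nat) (A : 'M[R]_(m, n.+1)).

Definition first_rows (k : nat) : seq 'rV[R]_n.+1 :=
  take k [seq row i A | i <- enum 'I_m].

(* The data after iteration k; k = 0 is the initialization. *)
Definition dd (k : nat) : dd_state := foldl dd_step dd_init (first_rows k).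

Definition dd_defined (k : nat) (v : point) : bool :=
  dd_run_defined (first_rows k) dd_init v.

End Input.

Definition homogeneous (P : {mpoly R[n.+1]}) : Prop :=
  exists d : nat, P \is d.-homog.

Definition peval (P : {mpoly R[n.+1]}) (v : point) : R := P.@[fun i => v i 0].

(* f, considered as a function on D, is the ratio of two homogeneous
   polynomials.  The denominator does not vanish on D, and it is not the zero
   polynomial even if D is empty; f is the ratio wherever the latter makes
   sense. *)
Definition homogeneous_ratio (D : point -> bool) (f : func) : Prop :=
  exists P Q : {mpoly R[n.+1]},
    [/\ homogeneous P, homogeneous Q, Q != 0,
        forall v, D v -> peval Q v != 0 &
        forall v, peval Q v != 0 -> f v = peval P v / peval Q v].

End DoubleDescription.

(* Main.v *)
Require Import Defs.
From mathcomp Require Import all_boot all_order all_algebra.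
From mathcomp Require Import reals.
From mathcomp Require Import mpoly.
From mathcomp Require Import zify.

(** Every function produced by the algorithm is a ratio [P / Q] of homogeneous
polynomials with [deg P = deg Q + 1].  Keeping track of this difference of
degrees is what makes the induction work: a sum of homogeneous polynomials is
homogeneous only when the degrees agree, and ratios of one common degree
difference are closed under addition, while differences add up under
multiplication and change sign under inversion.  The initial functions are the
coordinates, of degree 1.  A step of Case 1 forms linear combinations with
constant coefficients, and a step of Case 2 adds or creates multiples of
[mu_j * mu_i / Ntot], of degree [1 + 1 - 1 = 1] because [Ntot] is itself a
linear combination of the [mu_i].

The one delicate operation is the inversion of [Ntot].  It takes place only if
[beta] has both positive and negative entries, and then the run is defined only
where [Ntot] does not vanish.  When the numerator of [Ntot] is a nonzero polynomial, it becomes a factor of the new denominator, and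
it does not vanish where the run is defined, since [Ntot] does not.  When the
numerator is the zero polynomial, the run is defined nowhere, and wherever the
denominator of [Ntot] is nonzero the total inverse of [Ntot] is [0], which is a
ratio of any degree.  So nothing about the sign or the nonvanishing of the
[mu_i] is needed. *)

Set Implicit Arguments.
Unset Strict Implicit.
Unset Printing Implicit Defensive.

Import Order.TTheory GRing.Theory Num.Theory.
Local Open Scope ring_scope.

Section HomogeneousRatios.
Variables (R : realType) (n : nat).
Local Notation point := 'cV[R]_n.+1.
Local Notation func := (point -> R).

(** * Ratios of homogeneous polynomials of a given degree *)

(** [f] is on [D] the ratio of two homogeneous polynomials whose degrees differ
by the integer [e]; the conditions on the denominator are those of
[homogeneous_ratio].  The zero polynomial is homogeneous of every degree, so
[dP] and [dQ] are given explicitly. *)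
Definition ratio_of_degree (D : point -> bool) (e : int) (f : func) : Prop :=
  exists (P Q : {mpoly R[n.+1]}) (dP dQ : nat),
    [/\ P \is dP.-homog, Q \is dQ.-homog & dP%:Z = dQ%:Z + e] /\
    [/\ Q != 0, forall v, D v -> peval Q v != 0 &
        forall v, peval Q v != 0 -> f v = peval P v / peval Q v].

Lemma pevalM (P Q : {mpoly R[n.+1]}) v :
  peval (P * Q) v = peval P v * peval Q v.
Proof. exact: mevalM. Qed.

Lemma ratio_of_degree_homogeneous D e f :
  ratio_of_degree D e f -> homogeneous_ratio D f.
Proof.
move=> [P [Q [dP [dQ [[hP hQ _] [Q0 DQ fE]]]]]].
by exists P, Q; split=> //; [exists dP | exists dQ].
Qed.

Lemma ratio_of_degree_ext D e f g :
  f =1 g -> ratio_of_degree D e f -> ratio_of_degree D e g.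
Proof.
move=> fg [P [Q [dP [dQ [hd [Q0 DQ fE]]]]]].
by exists P, Q, dP, dQ; split=> //; split=> // v /fE; rewrite fg.
Qed.

Lemma ratio_of_degree0 D : ratio_of_degree D 1 (@fun0 R n).
Proof.
exists 0, 1, 1%N, 0%N; split; split; rewrite ?rpred0 ?dhomog1 ?oner_eq0 //.
- by move=> v _; rewrite /peval meval1 oner_eq0.
- by move=> v _; rewrite /peval meval0 mul0r.
Qed.

Lemma ratio_of_degree_coord D i : ratio_of_degree D 1 (fun v => v i 0).
Proof.
exists 'X_i, 1, 1%N, 0%N; split; split; rewrite ?dhomog1 ?oner_eq0 //.
- by rewrite dhomogX; apply/eqP; apply: mdeg1.
- by move=> v _; rewrite /peval meval1 oner_eq0.
- by move=> v _; rewrite /peval meval1 mevalXU divr1.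
Qed.

Lemma ratio_of_degreeD D e f g :
  ratio_of_degree D e f -> ratio_of_degree D e g ->
  ratio_of_degree D e (fun v => f v + g v).
Proof.
move=> [P [Q [dP [dQ [[hP hQ ab] [Q0 DQ fE]]]]]].
move=> [P' [Q' [dP' [dQ' [[hP' hQ' ab'] [Q'0 DQ' gE]]]]]].
exists (P * Q' + P' * Q), (Q * Q'), (dP + dQ')%N, (dQ + dQ')%N.
split; split.
- apply: rpredD; first exact: dhomogM.
  have -> : (dP + dQ' = dP' + dQ)%N by lia.
  exact: dhomogM.
- exact: dhomogM.
- lia.
- by rewrite mulf_neq0.
- by move=> v Dv; rewrite pevalM mulf_neq0 ?DQ ?DQ'.
- move=> v; rewrite pevalM mulf_eq0 negb_or => /andP[Qv Q'v].
  by rewrite fE // gE // /peval mevalD !mevalM addf_div.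
Qed.

Lemma ratio_of_degreeM D e e' f g :
  ratio_of_degree D e f -> ratio_of_degree D e' g ->
  ratio_of_degree D (e + e') (fun v => f v * g v).
Proof.
move=> [P [Q [dP [dQ [[hP hQ ab] [Q0 DQ fE]]]]]].
move=> [P' [Q' [dP' [dQ' [[hP' hQ' ab'] [Q'0 DQ' gE]]]]]].
exists (P * P'), (Q * Q'), (dP + dP')%N, (dQ + dQ')%N.
split; split; try exact: dhomogM.
- lia.
- by rewrite mulf_neq0.
- by move=> v Dv; rewrite pevalM mulf_neq0 ?DQ ?DQ'.
- move=> v; rewrite pevalM mulf_eq0 negb_or => /andP[Qv Q'v].
  by rewrite fE // gE // pevalM mulf_div.
Qed.

Lemma ratio_of_degreeZ D e c f :
  ratio_of_degree D e f -> ratio_of_degree D e (fun v => c * f v).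
Proof.
move=> [P [Q [dP [dQ [[hP hQ ab] [Q0 DQ fE]]]]]].
exists (c *: P), Q, dP, dQ; split; split=> //; first exact: rpredZ.
by move=> v Qv; rewrite fE // /peval mevalZ mulrA.
Qed.

(** The inverse is the total one.  If the numerator of [f] is the zero
polynomial, then [D] is empty and the inverse is [0] wherever the denominator
of [f] is nonzero. *)
Lemma ratio_of_degreeV (D : point -> bool) e f :
  (forall v, D v -> f v != 0) ->
  ratio_of_degree D e f -> ratio_of_degree D (- e) (fun v => (f v)^-1).
Proof.
move=> Df [P [Q [dP [dQ [[hP hQ ab] [Q0 DQ fE]]]]]].
have [P0|P0] := eqVneq P 0.
  have f0 v : peval Q v != 0 -> f v = 0.
    by move=> /fE ->; rewrite P0 /peval meval0 mul0r.
  (* The power of the coordinate makes room for a numerator of degree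
     [dQ + dP - e = dQ + dQ], which is a natural number. *)
  exists 0, (Q * 'X_ord0 ^+ dP), (dQ + dQ)%N, (dQ + dP)%N.
  split; split; rewrite ?rpred0 //.
  - apply: dhomogM => //.
    have := dhomogMn dP (_ : ('X_ord0 : {mpoly R[n.+1]}) \is 1.-homog).
    by rewrite mul1n; apply; rewrite dhomogX; apply/eqP; apply: mdeg1.
  - lia.
  - by rewrite mulf_neq0 // expf_neq0 // -msupp_eq0 msuppX.
  - by move=> v Dv; have := Df v Dv; rewrite f0 ?eqxx ?DQ.
  - move=> v; rewrite pevalM mulf_eq0 negb_or => /andP[Qv _].
    by rewrite f0 // invr0 /peval meval0 mul0r.
exists (Q * Q), (P * Q), (dQ + dQ)%N, (dP + dQ)%N.
split; split; try exact: dhomogM.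
- lia.
- by rewrite mulf_neq0.
- move=> v Dv; rewrite pevalM mulf_neq0 ?DQ //.
  by have := Df v Dv; rewrite fE ?DQ // mulf_eq0 negb_or => /andP[].
- move=> v; rewrite pevalM mulf_eq0 negb_or => /andP[Pv Qv].
  by rewrite fE // invf_div pevalM -mulf_div divff ?mulr1.
Qed.

Lemma ratio_of_degree_sum D (I : eqType) (r : seq I) (F : I -> func) :
  (forall i, i \in r -> ratio_of_degree D 1 (F i)) ->
  ratio_of_degree D 1 (fun v => \sum_(i <- r) F i v).
Proof.
elim: r => [|i r IHr] hF.
  apply: ratio_of_degree_ext (ratio_of_degree0 D) => v.
  by rewrite big_nil.
apply: (@ratio_of_degree_ext _ _ (fun v => F i v + \sum_(j <- r) F j v)).
  by move=> v; rewrite big_cons.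
apply: ratio_of_degreeD; first by apply: hF; rewrite mem_head.
by apply: IHr => j jr; apply: hF; rewrite inE jr orbT.
Qed.

(** * Sequences of ratios of degree one *)

(** All functions in [l] are ratios of degree 1.  No bound on the index is
needed, because the default [fun0] is such a ratio. *)
Definition ratios (D : point -> bool) (l : seq func) : Prop :=
  forall i, ratio_of_degree D 1 (nth (@fun0 R n) l i).

Lemma ratios_nil D : ratios D [::].
Proof. by move=> i; rewrite nth_nil; apply: ratio_of_degree0. Qed.

Lemma ratios_cons D f l :
  ratio_of_degree D 1 f -> ratios D l -> ratios D (f :: l).
Proof. by move=> hf hl [|i]; [apply: hf | apply: hl]. Qed.

Lemma ratios_cat D l l' : ratios D l -> ratios D l' -> ratios D (l ++ l').
Proof. by move=> hl hl' i; rewrite nth_cat; case: ifP. Qed.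

Lemma ratios_take D k l : ratios D l -> ratios D (take k l).
Proof.
move=> hl i; have [ik|ki] := ltnP i k; first by rewrite nth_take.
rewrite nth_default; first exact: ratio_of_degree0.
by rewrite (leq_trans _ ki) // size_take_min geq_minl.
Qed.

Lemma ratios_map D (I : eqType) (r : seq I) (F : I -> func) :
  (forall i, i \in r -> ratio_of_degree D 1 (F i)) ->
  ratios D [seq F i | i <- r].
Proof.
elim: r => [|i r IHr] hF /=; first exact: ratios_nil.
apply: ratios_cons; first by apply: hF; rewrite mem_head.
by apply: IHr => j jr; apply: hF; rewrite inE jr orbT.
Qed.

Lemma ratios_allpairs D (I J : eqType) (r : seq I) (s : seq J)
    (F : I -> J -> func) :
  (forall i j, i \in r -> j \in s -> ratio_of_degree D 1 (F i j)) ->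
  ratios D [seq F i j | i <- r, j <- s].
Proof.
elim: r => [|i r IHr] hF /=; first exact: ratios_nil.
apply: ratios_cat.
  by apply: ratios_map => j js; apply: hF; rewrite // mem_head.
by apply: IHr => k j kr js; apply: hF; rewrite // inE kr orbT.
Qed.

(** * The steps of the algorithm *)

Definition ratio_state (D : point -> bool) (s : dd_state R n) : Prop :=
  ratios D (dd_mu s) /\ ratios D (dd_theta s).

Lemma ratio_state_init D : ratio_state D (dd_init R n).
Proof.
split; last by apply: ratios_map => i _; apply: ratio_of_degree_coord.
by apply: ratios_cons (ratios_nil D); apply: ratio_of_degree_coord.
Qed.

Lemma ratio_state_step1 D a s : ratio_state D s -> ratio_state D (dd_step1 a s).
Proof.
case: s => L theta Rm mu [/= hmu htheta]; rewrite /dd_step1.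
have hdiv c f : ratio_of_degree D 1 f -> ratio_of_degree D 1 (fun v => f v / c).
  move=> /(ratio_of_degreeZ c^-1); apply: ratio_of_degree_ext => v.
  exact: mulrC.
have hlin b c f : ratio_of_degree D 1 f ->
    ratio_of_degree D 1 (fun v => b * f v / c).
  by move=> /(ratio_of_degreeZ b); apply: hdiv.
split=> /=; last first.
  apply: ratios_cat; first exact: ratios_take.
  by apply: ratios_map => j _; apply: hdiv.
apply: ratios_cons; last by apply: ratios_map => j _; apply: hdiv.
apply: ratio_of_degreeD; first apply: ratio_of_degreeD.
- case: (_ < 0); last exact: htheta.
  apply: ratio_of_degree_ext (ratio_of_degreeZ (-1) (htheta _)) => v.
  exact: mulN1r.
- by apply: ratio_of_degree_sum => j _; apply: hlin.
- by apply: ratio_of_degree_sum => j _; apply: hlin.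
Qed.

Lemma ratio_of_degree_Ntot D beta mu :
  ratios D mu -> ratio_of_degree D 1 (@dd_Ntot R n beta mu).
Proof.
move=> hmu; apply: ratio_of_degree_sum => i _.
apply: ratio_of_degree_ext (ratio_of_degreeZ beta`_i (hmu i)) => v.
exact: mulrC.
Qed.

Lemma ratio_state_step2 (D : point -> bool) a s :
  ~~ dd_case1 a s -> (forall v, D v -> dd_step_defined a s v) ->
  ratio_state D s -> ratio_state D (dd_step2 a s).
Proof.
case: s => L theta Rm mu ncase; rewrite /dd_step_defined ncase /=.
set beta := row_times a Rm => Ddef [/= hmu htheta].
split=> //=.
have hquot i j : i \in dd_Npos beta -> j \in dd_Nneg beta ->
    ratio_of_degree D 1 (fun v => nth (@fun0 R n) mu j v *
      nth (@fun0 R n) mu i v / dd_Ntot beta mu v).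
  move=> ipos jneg; apply: (@ratio_of_degreeM _ (1 + 1) (-1)).
    exact: ratio_of_degreeM.
  apply: ratio_of_degreeV; last exact: ratio_of_degree_Ntot.
  move=> v /Ddef /implyP; apply; apply/andP; split.
  - by apply/eqP => N0; rewrite N0 in ipos.
  - by apply/eqP => N0; rewrite N0 in jneg.
apply: ratios_cat; first by apply: ratios_map => i _.
apply: ratios_cat; last by apply: ratios_allpairs.
apply: ratios_map => i ipos; apply: ratio_of_degreeD => //.
apply: ratio_of_degree_sum => j jneg.
apply: ratio_of_degree_ext (ratio_of_degreeZ beta`_j (hquot i j ipos jneg)) => v.
by rewrite mulrA (mulrC beta`_j).
Qed.

Lemma ratio_state_step (D : point -> bool) a s :
  (forall v, D v -> dd_step_defined a s v) ->
  ratio_state D s -> ratio_state D (dd_step s a).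
Proof.
move=> Ddef hs; rewrite /dd_step; case: ifPn => [_|ncase].
  exact: ratio_state_step1.
exact: ratio_state_step2.
Qed.

Lemma ratio_state_run (D : point -> bool) rows s :
  (forall v, D v -> dd_run_defined rows s v) ->
  ratio_state D s -> ratio_state D (foldl (@dd_step R n) s rows).
Proof.
elim: rows s => //= a rows IHrows s Ddef hs.
apply: IHrows; first by move=> v /Ddef /andP[].
by apply: ratio_state_step hs => v /Ddef /andP[].
Qed.

End HomogeneousRatios.

Theorem proposition4 (R : realType) (m n : nat) (A : 'M[R]_(m, n.+1))
    (k : nat) (hk : (k <= m)%N) :
  (forall i : nat, (i < size (dd_mu (dd A k)))%N ->
     homogeneous_ratio (dd_defined A k) (nth (@fun0 R n) (dd_mu (dd A k)) i)) /\
  (forall j : nat, (j < size (dd_theta (dd A k)))%N ->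
     homogeneous_ratio (dd_defined A k) (nth (@fun0 R n) (dd_theta (dd A k)) j)).
Proof.
have [hmu htheta] : ratio_state (dd_defined A k) (dd A k).
  by apply: ratio_state_run => //; apply: ratio_state_init.
by split=> i _; apply: ratio_of_degree_homogeneous.
Qed.
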